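(* Let $X,Y,Z,W$ be locally convex Hausdorff topological vector spaces, $K\subset Y$ a proper closed convex cone with $\operatorname{int}K\ne\emptyset$, $P\subset W$ and $S\subset Z$ nonempty convex cones, $F\colon X\to Y^\infty$, $\kappa\colon W\to Y^\infty$, $H\colon X\to W^\infty$, $G\colon X\to Z^\infty$ proper mappings, $C\subset X$ nonempty, $A=C\cap G^{-1}(-S)$, and assume $A\cap\operatorname{dom}F\cap H^{-1}(\operatorname{dom}\kappa)\neq\emptyset$. Put $$\mathcal M^3=\bigcup_{T_1\in\operatorname{dom}\kappa^*,\; T_2\in\mathcal L_+^w(S,K)}\Psi\big(\mathfrak E\mathrm{pi}F^*\boxplus\mathfrak E\mathrm{pi}(T_1\circ H+T_2\circ G)^*\boxplus\mathfrak E\mathrm{pi}I_C^*\boxplus\{(0_{\mathcal L},\kappa^*(T_1)\uplus I_{-S}^*(T_2))\}\big),$$ $$\mathcal M^3_+=\bigcup_{T_1\in\operatorname{dom}\kappa^*\cap\mathcal L_+(P,K),\; T_2\in\mathcal L_+(S,K)}\Psi\big(\mathfrak E\mathrm{pi}F^*\boxplus\mathfrak E\mathrm{pi}(T_1\circ H+T_2\circ G)^*\boxplus\mathfrak E\mathrm{pi}I_C^*\boxplus\{(0_{\mathcal L},\kappa^*(T_1))\}\big).$$ Consider the statements: $(\mathrm a_3)$ $\operatorname{epi}(F+\kappa\circ H+I_A)^*=\mathcal M^3$; $(\mathrm b_3)$ $\operatorname{epi}(F+\kappa\circ H+I_A)^*=\mathcal M^3_+$; $(\mathrm e_3)$ stable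 strong duality holds for $(\mathrm{CCVP})-(\mathrm{CCVD}^3)$: for every $L\in\mathcal L(X,Y)$, $\operatorname{WInf}\{F(x)+(\kappa\circ H)(x)-L(x):x\in A\}=\operatorname{WMax}D_L$, where $D_L$ is the union over $L',L''\in\mathcal L(X,Y)$, $T_1\in\operatorname{dom}\kappa^*$, $T_2\in\mathcal L_+^w(S,K)$ of the sets $$-\big[F^*(L')\uplus(T_1\circ H+T_2\circ G)^*(L-L'-L'')\uplus I_C^*(L'')\uplus\kappa^*(T_1)\uplus I_{-S}^*(T_2)\big];$$ $(\mathrm f_3)$ stable strong duality holds for $(\mathrm{CCVP})-(\mathrm{CCVD}^3_\ell)$: for every $L\in\mathcal L(X,Y)$, $\operatorname{WInf}\{F(x)+(\kappa\circ H)(x)-L(x):x\in A\}=\operatorname{WMax}D_L^+$, where $D_L^+$ is the union over $L',L''\in\mathcal L(X,Y)$, $T_1\in\operatorname{dom}\kappa^*\cap\mathcal L_+(P,K)$, $T_2\in\mathcal L_+(S,K)$ of the sets $$-\big[F^*(L')\uplus(T_1\circ H+T_2\circ G)^*(L-L'-L'')\uplus I_C^*(L'')\uplus\kappa^*(T_1)\big].$$ Then $(\mathrm a_3)\Leftrightarrow(\mathrm e_3)$ and $(\mathrm b_3)\Leftrightarrow(\mathrm f_3)$.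
   Context: Ordering: $K$ proper means $K\neq Y$. $y_1<_K y_2$ iff $y_1-y_2\in-\operatorname{int}K$. $Y^\infty=Y\cup\{+\infty_Y\}$, $Y^\bullet=Y\cup\{\pm\infty_Y\}$, with $-\infty_Y<_Ky<_K+\infty_Y$ for $y\in Y$, $-\infty_Y<_K+\infty_Y$, $-(\pm\infty_Y)=\mp\infty_Y$, $y+(+\infty_Y)=+\infty_Y$ for $y\in Y^\infty$, $M+\{+\infty_Y\}=\{+\infty_Y\}$ for $M\subset Y$; similarly $W^\infty=W\cup\{+\infty_W\}$, $Z^\infty=Z\cup\{+\infty_Z\}$. For $M\subset Y^\bullet$: $\operatorname{WSup}M$ is the set of $\bar v\in Y^\bullet$ such that $\bar v\not<_Kv$ for all $v\in M$ and for every $\tilde v\in Y^\bullet$ with $\tilde v<_K\bar v$ there is $v\in M$ with $\tilde v<_Kv$; $\operatorname{WInf}M=-\operatorname{WSup}(-M)$; $\operatorname{WMax}M=M\cap\operatorname{WSup}M$. A mapping into $Y^\infty$ (or $W^\infty$, $Z^\infty$) is proper if its domain (set of points where it is not $+\infty$) is nonempty. $\kappa(+\infty_W)=+\infty_Y$. For $T\in\mathcal L(Z,Y)$ (continuous linear maps), $(T\circ G)(x)=T(G(x))$ if $G(x)\in Z$ and $+\infty_Y$ otherwise; likewise $T\circ H$. $I_D(x)=0_Y$ if $x\in D$, $+\infty_Y$ otherwise. $0_{\mathcal L}$ is the zero of $\mathcal L(X,Y)$. $\mathcal L_+(S,K)=\{T\in\mathcal L(Z,Y):T(S)\subset K\}$,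 $\mathcal L_+^w(S,K)=\{T\in\mathcal L(Z,Y):T(S)\cap(-\operatorname{int}K)=\emptyset\}$, and $\mathcal L_+(P,K)$ is defined analogously. Conjugates: for $E\colon X\to Y^\infty$, $E^*(L)=\operatorname{WSup}\{L(x)-E(x):x\in X\}$, $\operatorname{dom}E^*=\{L:E^*(L)\neq\{+\infty_Y\}\}$, $\operatorname{epi}E^*=\{(L,y)\in\mathcal L(X,Y)\times Y:y\in E^*(L)+K\}$; likewise for mappings on $W$, $Z$ ($\kappa^*$, $I_{-S}^*$). Set order: for nonempty $M,N\subset Y^\bullet$, $M\preccurlyeq_KN$ iff $v\not<_Ku$ for all $u\in M$, $v\in N$. $\mathcal P_p(Y)$ is the collection of $U\subset Y$ such that $Y$ is the disjoint union of $U-\operatorname{int}K$, $U$, $U+\operatorname{int}K$; $\mathcal P_p(Y)^\infty=\mathcal P_p(Y)\cup\{\{+\infty_Y\}\}$. For $U,V\in\mathcal P_p(Y)^\infty$, $U\uplus V=\operatorname{WSup}(U+V)$ (a commutative, associative operation). Extended epigraph: $\mathfrak E\mathrm{pi}E^*=\{(L,U)\in\mathcal L(X,Y)\times\mathcal P_p(Y):L\in\operatorname{dom}E^*,\ E^*(L)\preccurlyeq_KU\}$. $\mathscr M\boxplus\mathscr N=\{(L_1+L_2,U_1\uplus U_2):(L_1,U_1)\in\mathscr M,(L_2,U_2)\in\mathscr N\}$. $\Psi$ is the set-valued map from $\mathcal L(X,Y)\times\mathcal P_p(Y)$ to $\mathcal L(X,Y)\times Y$ given by $\Psi(L,U)=\{L\}\times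 U$, and $\Psi(\mathscr M)=\bigcup_{(L,U)\in\mathscr M}\Psi(L,U)$. $(\mathrm{CCVP})$ is the problem $\operatorname{WInf}\{F(x)+(\kappa\circ H)(x):x\in C,\ G(x)\in-S\}$; $(\mathrm{CCVD}^3)$ and $(\mathrm{CCVD}^3_\ell)$ are its Fenchel-Lagrange duals, obtained from $D_L$ and $D_L^+$ with $L=0_{\mathcal L}$.
   Formalization: Each equivalence gets a premise: the set of admissible T₁ (dom κ*, resp. dom κ*∩L₊(P,K)) or dom(F+κ∘H+I_A)* is nonempty. Otherwise (a₃),(b₃) hold with both sides empty, but WMax ∅=∅ makes (e₃),(f₃) fail, e.g. on R with κ(w)=−w², H=id, F=G=0. *)

(* Defs.v *)
From HB Require Import structures.
From mathcomp Require Import all_boot all_order all_algebra.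
From mathcomp Require Import all_classical all_reals all_analysis.

Set Implicit Arguments.
Unset Strict Implicit.
Unset Printing Implicit Defensive.

Import Order.TTheory GRing.Theory Num.Theory.

Local Open Scope classical_set_scope.
Local Open Scope ring_scope.

Section ContinuousLinear.
Context {R : realType} (X Y : tvsType R).

Definition clin_set : set (X -> Y) := [set f | linear f /\ continuous f].

Definition clin_pred : {pred X -> Y} := mem clin_set.

Lemma clin_zmod_closed : zmod_closed clin_pred.
Proof.
split=> [|f g]; rewrite !inE /clin_set /=.
  split=> [a u v|x]; last exact: cvg_cst.
  by rewrite /GRing.zero /= scaler0 addr0.
move=> [lf cf] [lg cg]; split=> [a u v|x].
  rewrite -[(f - g) (a *: u + v)]/(f (a *: u + v) - g (a *: u + v)).
  rewrite -[(f - g) u]/(f u - g u) -[(f - g) v]/(f v - g v).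
  by rewrite lf lg scalerBr opprD addrACA.
apply: (@continuous_comp X (Y * Y)%type Y (fun x => (f x, g x))
  (fun p => p.1 - p.2)); last exact: sub_continuous.
by apply: cvg_pair; [exact: cf|exact: cg].
Qed.

HB.instance Definition _ :=
  GRing.isZmodClosed.Build (X -> Y) clin_pred clin_zmod_closed.

(* The space L(X, Y) of continuous linear maps, an additive group under the
   pointwise operations. *)
Record clin := Clin { clin_fun :> X -> Y ; _ : clin_fun \in clin_pred }.

HB.instance Definition _ := [isSub for clin_fun].
HB.instance Definition _ := [Choice of clin by <:].
HB.instance Definition _ := [SubChoice_isSubZmodule of clin by <:].

End ContinuousLinear.

Section Cones.
Context {R : realType} {E : tvsType R}.

(* 0 need not belong to a cone; this covers the convention requiring it. *)
Definition convex_cone (S : set E) :=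
  convex_set S /\ forall (t : R) (x : E), 0 < t -> S x -> S (t *: x).

End Cones.

(* The space E with both infinities adjoined is [\bar E]; a mapping into
   E with only +oo adjoined is a function into [\bar E] avoiding -oo. The
   library's conventions on [\bar E] give y + (+oo) = +oo for y <> -oo and
   - (+oo) = -oo; the sum (+oo) + (-oo) never occurs below. *)
Section ExtendedMaps.
Context {R : realType}.

Definition edom {X E : Type} (f : X -> \bar E) : set X :=
  [set x | f x <> +oo%E].

Definition eproper {X E : Type} (f : X -> \bar E) :=
  (forall x, f x <> -oo%E) /\ edom f !=set0.

(* [H] avoids -oo wherever this is used, so the default case is +oo. *)
Definition ecomp {X W E : Type} (f : W -> \bar E) (H : X -> \bar W) (x : X)
    : \bar E :=
  if H x is w%:E%E then f w else +oo%E.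

Definition lcomp {X : Type} {Z Y : tvsType R} (T : clin Z Y) (G : X -> \bar Z)
    : X -> \bar Y :=
  ecomp (fun z => (T z)%:E%E) G.

Definition indf {X : Type} {Y : tvsType R} (D : set X) (x : X) : \bar Y :=
  if x \in D then 0%:E%E else +oo%E.

End ExtendedMaps.

Section WeakOrder.
Context {R : realType} {Y : tvsType R} (K : set Y).
Implicit Types (u v w : \bar Y) (M N : set (\bar Y)).

Definition klt u v : Prop :=
  match u, v with
  | y1%:E, y2%:E => (-%R @` interior K) (y1 - y2)%R
  | -oo, _%:E | -oo, +oo | _%:E, +oo => True
  | _, _ => False
  end%E.

Definition eneg M : set (\bar Y) := oppe @` M.

Definition wsup M : set (\bar Y) :=
  [set w | (forall v, M v -> ~ klt w v) /\
           (forall t, klt t w -> exists2 v, M v & klt t v)].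

Definition winf M : set (\bar Y) := eneg (wsup (eneg M)).

Definition wmax M : set (\bar Y) := M `&` wsup M.

Definition kprec M N : Prop := forall u v, M u -> N v -> ~ klt v u.

Definition wpartition (U : set Y) : Prop :=
  let D := [set u - k | u in U & k in interior K] in
  let V := [set u + k | u in U & k in interior K] in
  [/\ D `|` U `|` V = setT, D `&` U = set0, U `&` V = set0 & D `&` V = set0].

(* P_p(Y), its members being seen as subsets of [\bar Y]. *)
Definition Pp : set (set (\bar Y)) := [set EFin @` U | U in wpartition].

Definition uplus M N : set (\bar Y) := wsup [set (u + v)%E | u in M & v in N].

End WeakOrder.

Section Conjugates.
Context {R : realType} {X Y : tvsType R} (K : set Y).
Implicit Types (E : X -> \bar Y) (M N : set (clin X Y * set (\bar Y))).

Definition conjug E (L : clin X Y) : set (\bar Y) :=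
  wsup K (range (fun x => (L x)%:E - E x)%E).

Definition dom_conj E : set (clin X Y) := [set L | conjug E L <> [set +oo%E]].

Definition epi_conj E : set (clin X Y * Y) :=
  [set p | [set (u + k%:E)%E | u in conjug E p.1 & k in K] p.2%:E%E].

Definition Epi_conj E : set (clin X Y * set (\bar Y)) :=
  [set p | [/\ Pp K p.2, dom_conj E p.1 & kprec K (conjug E p.1) p.2]].

Definition boxplus M N : set (clin X Y * set (\bar Y)) :=
  [set (p.1 + q.1, uplus K p.2 q.2) | p in M & q in N].

(* Psi takes its values in subsets of L(X, Y) * Y: a pair (L, {+oo}), which
   [boxplus] may produce, contributes nothing. *)
Definition Psi M : set (clin X Y * Y) :=
  [set p | exists2 U, M (p.1, U) & U p.2%:E%E].

End Conjugates.

Section PositiveOperators.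
Context {R : realType} {Z Y : tvsType R} (S : set Z) (K : set Y).

Definition Lplus : set (clin Z Y) := [set T | T @` S `<=` K].

Definition Lplusw : set (clin Z Y) :=
  [set T | (T @` S) `&` (-%R @` interior K) = set0].

End PositiveOperators.

Section CompositeProblem.
Context {R : realType} {X Y Z W : tvsType R}.
Variables (K : set Y) (P : set W) (S : set Z) (C : set X).
Variables (F : X -> \bar Y) (kappa : W -> \bar Y).
Variables (H : X -> \bar W) (G : X -> \bar Z).

Local Notation "U ⊎ V" := (uplus K U V) (at level 50, left associativity).
Local Notation "M ⊞ N" := (boxplus K M N) (at level 50, left associativity).
Local Notation cj := (conjug K).
Local Notation Epi := (Epi_conj K).

Definition feasible : set X := C `&` G @^-1` (EFin @` (-%R @` S)).

Definition objective (x : X) : \bar Y :=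
  (F x + ecomp kappa H x + indf feasible x)%E.

Definition I_negS : Z -> \bar Y := indf (-%R @` S).

Definition lagr (T1 : clin W Y) (T2 : clin Z Y) (x : X) : \bar Y :=
  (lcomp T1 H x + lcomp T2 G x)%E.

Definition M3 : set (clin X Y * Y) :=
  [set p | exists T1 T2, [/\ dom_conj K kappa T1, Lplusw S K T2 &
    Psi (Epi F ⊞ Epi (lagr T1 T2) ⊞ Epi (indf C)
         ⊞ [set (0, cj kappa T1 ⊎ cj I_negS T2)]) p]].

Definition M3_plus : set (clin X Y * Y) :=
  [set p | exists T1 T2, [/\ (dom_conj K kappa `&` Lplus P K) T1,
                             Lplus S K T2 &
    Psi (Epi F ⊞ Epi (lagr T1 T2) ⊞ Epi (indf C) ⊞ [set (0, cj kappa T1)]) p]].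

Definition primal (L : clin X Y) : set (\bar Y) :=
  winf K [set (F x + ecomp kappa H x - (L x)%:E)%E | x in feasible].

Definition dual3 (L : clin X Y) : set (\bar Y) :=
  [set v | exists L' L'' T1 T2, [/\ dom_conj K kappa T1, Lplusw S K T2 &
    eneg (cj F L' ⊎ cj (lagr T1 T2) (L - L' - L'') ⊎ cj (indf C) L''
          ⊎ cj kappa T1 ⊎ cj I_negS T2) v]].

Definition dual3_plus (L : clin X Y) : set (\bar Y) :=
  [set v | exists L' L'' T1 T2, [/\ (dom_conj K kappa `&` Lplus P K) T1,
                                    Lplus S K T2 &
    eneg (cj F L' ⊎ cj (lagr T1 T2) (L - L' - L'') ⊎ cj (indf C) L''
          ⊎ cj kappa T1) v]].

Definition stable_strong_duality (D : clin X Y -> set (\bar Y)) : Prop :=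
  forall L, primal L = wmax K (D L).

End CompositeProblem.

(* Main.v *)
(* A set M of extended vectors enters WSup M only through its strict lower set
   low M = {y in Y : y <_K v for some v in M}: WSup M is the "cut" made of the
   boundary points of low M, degenerating to {+oo} or {-oo} when low M is Y or
   empty. Conversely low (cut A) = A for such lower sets A, and low turns the
   sum of P_p(Y)^oo into the Minkowski sum of lower sets. Hence
   - y lies in E*(L) + K iff y is not in low E*(L);
   - (L, y) lies in M^3 iff y is outside one of the Minkowski sums A of the
     lower sets of the conjugates occurring in D_L;
   - the primal value is -cut A0, with A0 the lower set of the conjugate of the
     objective at L, and D_L is the union of the sets -cut A.
   The epigraph identity then says that A0 is the intersection of the family of
   all the A, and so does the equality of -cut A0 with WMax of the union of the
   -cut A; weak duality is implied by either of them. *)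

Require Import Defs.
From mathcomp Require Import all_boot all_order all_algebra.
From mathcomp Require Import all_classical all_reals all_analysis.

Set Implicit Arguments.
Unset Strict Implicit.
Unset Printing Implicit Defensive.

Import Order.TTheory GRing.Theory Num.Theory.

Local Open Scope classical_set_scope.
Local Open Scope ring_scope.

(** * Solid cones *)

Section OrderingCone.
Context {R : realType} {Y : tvsType R} {K : set Y} (Kcone : convex_cone K).

(** The sum is twice the midpoint of [x] and [y]. *)
Lemma cone_add (x y : Y) : K x -> K y -> K (x + y).
Proof.
case: Kcone => Kconv Kscale Kx Ky.
have h : (0 : R) < 2^-1 by rewrite invr_gt0.
have h1 : (2^-1 : R) <= 1 by rewrite invf_le1// ler1n.
have /set_mem := Kconv x y (Itv01 (ltW h) h1) (mem_set Kx) (mem_set Ky).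
rewrite /conv /= /unstable.onem => /(Kscale 2 _ (ltr0n _ 2)).
rewrite scalerDr !scalerA mulrBr mulr1 mulfV ?pnatr_eq0// scale1r.
by rewrite (_ : 2 - 1 = 1) ?scale1r// -[2](natrD _ 1 1) addrK.
Qed.

Lemma cone_interior_add (k c : Y) : K^° k -> K c -> K^° (k + c).
Proof.
rewrite [k + c]addrC => /(nbhsB c) Kk Kc; apply: filterS Kk.
by move=> _ [y Ky <-]; exact: cone_add.
Qed.

Lemma cone_interior_scale (t : R) (k : Y) : 0 < t -> K^° k -> K^° (t *: k).
Proof.
move=> t0 Kk; apply: filterS (nbhsZ (lt0r_neq0 t0) Kk).
by move=> _ [y Ky <-]; exact: (proj2 Kcone).
Qed.

Lemma cone_interior_half (k : Y) : K^° k ->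
  exists2 h, K^° h & k = h + h.
Proof.
move=> Kk; exists (2^-1 *: k).
  by apply: cone_interior_scale; rewrite ?invr_gt0.
by rewrite -scalerDl -{1}[k]scale1r [in LHS](splitr 1) !div1r.
Qed.

(** By continuity of scaling, [e *: - y] enters the neighbourhood [A - k] of 0 for small [e]. *)
Lemma line_nbhs (A : set Y) (k y : Y) : nbhs k A ->
  exists2 e : R, 0 < e & A (k - e *: y).
Proof.
move=> Ak.
have : nbhs (0 *: - y) (+%R (- k) @` A).
  by rewrite scale0r -(addNr k); exact: nbhsB.
move=> /(@scale_continuous R Y (0, - y))[[U V] /= [U0 Vy] UVA].
have /nbhs_ballP[e /= e0 eU] := U0.
have /UVA[a Aa /= ka] : (U `*` V) (e / 2, - y).
  split=> /=; last exact: nbhs_singleton.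
  apply: eU; rewrite /ball /= sub0r normrN gtr0_norm ?divr_gt0//.
  by rewrite ltr_pdivrMr// mulr_natr mulr2n ltrDl.
exists (e / 2); first by rewrite divr_gt0.
by rewrite -scalerN -ka addrA subrr add0r.
Qed.

Lemma cone_interior_line (k y : Y) : K^° k ->
  exists2 e : R, 0 < e & K^° (k - e *: y).
Proof.
by move=> Kk; apply: line_nbhs; apply: open_nbhs_nbhs; split=> //;
  exact: open_interior.
Qed.

Lemma cone_interior_absorbing (k y : Y) : K^° k ->
  exists2 t : R, 0 < t & K^° (t *: k - y).
Proof.
move=> Kk; have [e e0 Ke] := cone_interior_line y Kk.
exists e^-1; first by rewrite invr_gt0.
have := cone_interior_scale (t := e^-1) _ Ke; rewrite invr_gt0 => /(_ e0).
by rewrite scalerBr scalerA mulVf ?gt_eqF// scale1r.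
Qed.

Context (Kclosed : closed K) (Kproper : K <> setT) (Kint : K^° !=set0).

(** If 0 were outside the closed set [K], some neighbourhood of 0 would miss [K], yet it contains a
    small positive multiple of an interior point. *)
Lemma cone0 : K 0.
Proof.
apply: contrapT => nK0; have [k Kk] := Kint.
have : nbhs 0 (~` K) by apply: open_nbhs_nbhs; split=> //; exact: closed_openC.
move=> /(line_nbhs (- k))[e e0]; apply.
rewrite sub0r scalerN opprK.
by apply: (proj2 Kcone) => //; exact: interior_subset.
Qed.

(** An interior 0 would absorb every vector, so [K] would be the whole space. *)
Lemma cone_interior_n0 : ~ K^° 0.
Proof.
move=> K0; apply: Kproper; rewrite -subTset => y _.
have [t t0] := cone_interior_absorbing (- y) K0.
by rewrite scaler0 sub0r opprK => /interior_subset.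
Qed.

End OrderingCone.

(** * Lower sets and weak suprema *)

Definition sumset {V : zmodType} (A B : set V) : set V :=
  [set a + b | a in A & b in B].

Lemma sumsetA {V : zmodType} (A B D : set V) :
  sumset A (sumset B D) = sumset (sumset A B) D.
Proof.
apply/seteqP; split=> [_ [a Aa [_ [b Bb [d Dd <-]] <-]]|].
  by exists (a + b); [exists a => //; exists b|exists d; rewrite ?addrA].
move=> _ [_ [a Aa [b Bb <-]] [d Dd <-]].
by exists a => //; exists (b + d); [exists b => //; exists d|rewrite addrA].
Qed.

Lemma sumset_n0 {V : zmodType} (A B : set V) :
  A !=set0 -> B !=set0 -> sumset A B !=set0.
Proof. by move=> [a Aa] [b Bb]; exists (a + b), a => //; exists b. Qed.

Lemma sumsetS {V : zmodType} (A A' B B' : set V) :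
  A `<=` A' -> B `<=` B' -> sumset A B `<=` sumset A' B'.
Proof.
by move=> AA BB _ [a /AA Aa [b /BB Bb <-]]; exists a => //; exists b.
Qed.

Lemma sumset_neqT {V : zmodType} (A B : set V) : A !=set0 -> B !=set0 ->
  sumset A B <> setT -> A <> setT /\ B <> setT.
Proof.
move=> [a Aa] [b Bb] nT; split=> ET; apply: nT; rewrite -subTset => x _.
  by exists (x - b); [rewrite ET|exists b; rewrite ?subrK].
by exists a => //; exists (x - a); [rewrite ET|rewrite addrC subrK].
Qed.

Lemma sumset_shift {V : zmodType} (A B : set V) (c : V) :
  sumset [set x | A (x - c)] B = [set x | sumset A B (x - c)].
Proof.
apply/seteqP; split=> [_ [a Aa [b Bb <-]]|x [a Aa [b Bb abx]]] /=.
  by exists (a - c) => //; exists b => //; rewrite addrAC.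
exists (a + c); rewrite /= ?addrK//; exists b => //.
by rewrite addrAC abx subrK.
Qed.

Section WeakSuprema.
Context {R : realType} {Y : tvsType R} (K : set Y).

Definition low (M : set (\bar Y)) : set Y :=
  [set y | exists2 v, M v & klt K y%:E%E v].

(** This is the equation [O = O - K^°]: left to right it is openness upwards, right to left it is
    downward closedness. *)
Definition lowset (O : set Y) : Prop :=
  forall y, O y <-> exists2 k, K^° k & O (y + k).

Definition cut (O : set Y) : set (\bar Y) := fun w =>
  match w with
  | y%:E%E => ~ O y /\ forall k, K^° k -> O (y - k)
  | +oo%E => O = setT
  | -oo%E => O = set0
  end.

Lemma kltE (y z : Y) : klt K y%:E%E z%:E%E = K^° (z - y).
Proof.
apply/propext; split=> [[k Kk /eqP]|Kzy].
  by rewrite eqr_oppLR opprB => /eqP <-.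
by exists (z - y); rewrite ?opprB.
Qed.

Context (Kcone : convex_cone K) (Kclosed : closed K).
Context (Kint : K^° !=set0).

Lemma lowset_le (O : set Y) (y z : Y) : lowset O -> O z -> K (z - y) -> O y.
Proof.
move=> lO /lO[k Kk Ozk] Kzy; apply/lO; exists (k + (z - y)).
  exact: cone_interior_add.
by rewrite addrCA [y + _]addrC subrK addrC.
Qed.

Lemma lowset_lt (O : set Y) (y z : Y) : lowset O -> O z -> K^° (z - y) -> O y.
Proof. by move=> lO Oz /interior_subset; exact: lowset_le. Qed.

Lemma lowset_sub (O : set Y) (y k : Y) : lowset O -> O y -> K^° k -> O (y - k).
Proof. by move=> lO Oy Kk; apply: (lowset_lt lO Oy); rewrite subKr. Qed.

Lemma lowset_low (M : set (\bar Y)) : lowset (low M).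
Proof.
have [k0 Kk0] := Kint.
move=> y; split=> [[[z| |] Mz]|[k Kk [[z| |] Mz]]] //.
- rewrite kltE => /(cone_interior_half Kcone)[h Kh zy].
  exists h => //; exists z%:E%E => //; rewrite kltE opprD addrA zy.
  by rewrite addrK.
- by exists k0 => //; exists +oo%E.
- rewrite kltE => Kz; exists z%:E%E => //; rewrite kltE.
  have := cone_interior_add Kcone Kz (interior_subset Kk).
  by rewrite opprD addrA subrK.
- by exists +oo%E.
Qed.

(** The real points strictly below [y] are the [y - k] with [k] interior, which turns the second
    clause of [wsup] into that of [cut]. At +oo every real point is tested, and at -oo no element of
    [M] may exceed -oo. *)
Lemma wsupE (M : set (\bar Y)) : wsup K M = cut (low M).
Proof.
have [k0 Kk0] := Kint.
have low_ninfty v : M v -> klt K -oo%E v -> low M !=set0.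
  case: v => [z| |] Mv // _; last by exists 0, +oo%E.
  by exists (z - k0), z%:E%E => //; rewrite kltE subKr.
have ninfty_low y : low M y -> exists2 v, M v & klt K -oo%E v.
  by case=> -[z| |] // Mv _; [exists z%:E%E|exists +oo%E].
apply/seteqP; split=> -[y| |].
- case=> My tM; split=> [[v Mv]|k Kk]; first exact: My.
  by have [|v Mv yv] := tM (y - k)%:E%E; [rewrite kltE subKr|exists v].
- case=> _ tM; rewrite /= -subTset => y _.
  by have [|v Mv yv] := tM y%:E%E; [|exists v].
- case=> My _; rewrite /= -subset0 => z [v Mv zv]; apply: (My v Mv).
  by case: v Mv zv.
- case=> nMy Mk; split=> [v Mv yv|[t| |] //].
  + by apply: nMy; exists v.
  + rewrite kltE => /Mk; rewrite subKr => -[v Mv tv]; by exists v.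
  + by move=> _; exact: ninfty_low (Mk _ Kk0).
- move=> /= MT; split=> [[v| |] _ []|[t| |] // _].
  + by have : low M t by rewrite MT.
  + by apply: (ninfty_low 0); rewrite MT.
- move=> /= M0; split=> [v Mv vt|[t| |] //].
  by have [z] := low_ninfty _ Mv vt; rewrite M0.
Qed.

(** The boundary is met at the supremum of the parameters whose points lie in [O]. Openness of [O]
    along the line makes [a < t] strict. *)
Lemma cut_between (O : set Y) (y k : Y) (a b : R) : lowset O -> K^° k ->
  O (y + a *: k) -> ~ O (y + b *: k) ->
  exists t, [/\ a < t, t <= b & cut O (y + t *: k)%:E%E].
Proof.
move=> lO Kk Oa nOb; pose E := [set t : R | O (y + t *: k)].
have E0 : E !=set0 by exists a.
have ubE : ubound E b.
  move=> t Et; rewrite leNgt; apply/negP => bt; apply: nOb.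
  apply: (lowset_lt lO Et).
  rewrite opprD addrACA subrr add0r -scalerBl.
  by apply: cone_interior_scale; rewrite ?subr_gt0.
have supE : has_sup E by split=> //; exists b.
have openE t : E t -> exists2 e, 0 < e & E (t + e).
  move=> /lO[k' Kk' Ok']; have [e e0 Ke] := cone_interior_line k Kk'.
  exists e => //; apply: (lowset_lt lO Ok').
  by rewrite scalerDl addrA opprD addrA [_ + k']addrC addrK.
have Elt t : E t -> t < sup E.
  move=> /openE[e e0 Ete]; apply: (@lt_le_trans _ _ (t + e)); last first.
    exact: (ub_le_sup supE.2).
  by rewrite ltrDl.
exists (sup E); split; first exact: Elt.
  exact: ge_sup.
split=> [/Elt|k' Kk']; first by rewrite ltxx.
(* Going down by [k'] descends by more than [e *: k], while some [s] in [E] is within [e] of the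
   supremum. *)
have [e e0 Ke] := cone_interior_line k Kk'.
have [s Es ts] := sup_adherent e0 supE.
apply: (lowset_lt lO Es).
rewrite (_ : _ - _ = (s - (sup E - e)) *: k + (k' - e *: k)).
  apply: cone_interior_add => //; last exact: interior_subset.
  by apply: cone_interior_scale; rewrite ?subr_gt0.
rewrite !scalerBl !opprB [e *: k - _]addrC [k' - e *: k]addrC !addrA addrK.
by rewrite -addrA addrCA opprD addrACA subrr add0r addrC.
Qed.

Lemma cut_above (O : set Y) (y : Y) : lowset O -> O y -> O <> setT ->
  exists2 w, cut O w%:E%E & K^° (w - y).
Proof.
move=> lO Oy /eqP/setTPn[z nOz]; have [k Kk] := Kint.
have [b b0 Kb] := cone_interior_absorbing Kcone (z - y) Kk.
have nOb : ~ O (y + b *: k).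
  move=> Ob; apply: nOz; apply: (lowset_lt lO Ob).
  by move: Kb; rewrite opprB addrA [b *: k + y]addrC.
have O0 : O (y + 0 *: k) by rewrite scale0r addr0.
have [t [t0 _ Ot]] := cut_between lO Kk O0 nOb.
exists (y + t *: k) => //; rewrite addrAC subrr add0r.
exact: cone_interior_scale.
Qed.

(** Only [K (y - w)] can be claimed: [y] may itself lie on the cut, which is the case [t = 0]. *)
Lemma cut_below (O : set Y) (y : Y) : lowset O -> ~ O y -> O !=set0 ->
  exists2 w, cut O w%:E%E & K (y - w).
Proof.
move=> lO nOy [z Oz]; have [k Kk] := Kint.
have [b b0 Kb] := cone_interior_absorbing Kcone (y - z) Kk.
have nO0 : ~ O (y + 0 *: k) by rewrite scale0r addr0.
have Ob : O (y + - b *: k).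
  apply: (lowset_lt lO Oz); move: Kb.
  by rewrite scaleNr !opprB addrCA addrC -addrA [- y + z]addrC.
have [t [_ t0 Ot]] := cut_between lO Kk Ob nO0.
exists (y + t *: k) => //; rewrite opprD addNKr -scaleNr.
have [->|tn0] := eqVneq t 0; first by rewrite oppr0 scale0r; exact: cone0.
apply: (proj2 Kcone); last exact: interior_subset.
by rewrite oppr_gt0 lt_neqAle tn0.
Qed.

Lemma low_cut (O : set Y) : lowset O -> low (cut O) = O.
Proof.
move=> lO; apply/seteqP; split=> [y [[w| |]] //|y Oy].
- by case=> _ Ow; rewrite kltE => /Ow; rewrite subKr.
- by move=> /= ->.
have [->|/eqP OT] := eqVneq O setT; first by exists +oo%E.
by have [w Ow Kw] := cut_above lO Oy OT; exists w%:E%E; rewrite ?kltE.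
Qed.

Lemma low_wsup (M : set (\bar Y)) : low (wsup K M) = low M.
Proof. by rewrite wsupE low_cut//; exact: lowset_low. Qed.

Lemma low_add (M N : set (\bar Y)) :
  low [set (u + v)%E | u in M & v in N] = sumset (low M) (low N).
Proof.
have [k0 Kk0] := Kint.
apply/seteqP; split=> [y [_ [u Mu [v Nv <-]]]|_ [a [u Mu au] [b [v Nv bv] <-]]].
- case: u v Mu Nv => [u| |] [v| |] // Mu Nv => [|_|_|_].
  + rewrite -[(_ + _)%E]/((u + v)%:E%E) kltE.
    move=> /(cone_interior_half Kcone)[h Kh uvy].
    exists (u - h); first by exists u%:E%E; rewrite ?kltE ?subKr.
    exists (v - h); first by exists v%:E%E; rewrite ?kltE ?subKr.
    by rewrite addrACA -opprD -uvy subKr.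
  (* The lower set of +oo is the whole space, so any point below the finite summand can be completed
     to [y]. *)
  + exists (u - k0); first by exists u%:E%E; rewrite ?kltE ?subKr.
    by exists (y - (u - k0)); [exists +oo%E|rewrite addrC subrK].
  + exists (y - (v - k0)); first by exists +oo%E.
    by exists (v - k0); [exists v%:E%E; rewrite ?kltE ?subKr|rewrite subrK].
  + exists y; first by exists +oo%E.
    by exists 0; [exists +oo%E|rewrite addr0].
- exists (u + v)%E; first by exists u => //; exists v.
  case: u v {Mu Nv} au bv => [u| |] [v| |] //.
  rewrite -[(_ + _)%E]/((u + v)%:E%E) !kltE => Ku Kv; rewrite opprD addrACA.
  by apply: cone_interior_add => //; exact: interior_subset.
Qed.

Lemma low_uplus (M N : set (\bar Y)) :
  low (uplus K M N) = sumset (low M) (low N).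
Proof. by rewrite /uplus low_wsup low_add. Qed.

(** Each summand is [low] of its cut, so the sum is itself of the form [low M]. *)
Lemma lowset_sum (A B : set Y) : lowset A -> lowset B -> lowset (sumset A B).
Proof.
move=> lA lB; rewrite -[A]low_cut// -[B]low_cut// -low_add.
exact: lowset_low.
Qed.

Lemma uplusE (M N : set (\bar Y)) :
  uplus K M N = cut (sumset (low M) (low N)).
Proof. by rewrite /uplus wsupE low_add. Qed.

Lemma enegE (M : set (\bar Y)) v : eneg M v = M (oppe v).
Proof.
apply/propext; split=> [[u Mu <-]|Mv].
  by case: u Mu => [u| |]; rewrite /= ?opprK.
by exists (oppe v) => //; case: v {Mv} => [v| |]; rewrite /= ?opprK.
Qed.

Lemma cutT : cut setT = [set +oo%E].
Proof.
apply/seteqP; split=> [[w [/(_ I) []]|//|/= T0]|_ ->//].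
by have : @setT Y 0 by []; rewrite T0.
Qed.

Lemma Pp_cut (O : set Y) : lowset O -> O !=set0 -> O <> setT -> Pp K (cut O).
Proof.
move=> lO O0 OT; exists [set y | cut O y%:E%E]; last first.
  apply/seteqP; split=> [_ [y Oy <-]//|[y| |] Oy]; first by exists y.
    by have := OT Oy.
  by have [z] := O0; rewrite (Oy : O = set0).
split.
- rewrite -subTset => y _.
  have [Oy|nOy] := pselect (O y).
    left; left; have [w Ow Kw] := cut_above lO Oy OT.
    by exists w => //; exists (w - y); rewrite ?subKr.
  (* Outside [O], either there is room below [y], which is then strictly above a cut point, or [y]
     is on the cut. *)
  have [[k Kk nOk]|nk] := pselect (exists2 k, K^° k & ~ O (y - k)).
    right; have [w Ow Kw] := cut_below lO nOk O0.
    exists w => //; exists (k + (y - k - w)); first exact: cone_interior_add.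
    by rewrite addrCA [w + _]addrC subrK addrC subrK.
  left; right; split=> // k Kk; apply: contrapT => nOk.
  by apply: nk; exists k.
- rewrite -subset0 => _ [[w [_ Ow] [k Kk <-]] [nO _]].
  exact: nO (Ow _ Kk).
- rewrite -subset0 => y [[_ Oy] [w [nOw _] [k Kk wk]]].
  by apply: nOw; rewrite -(addrK k w) wk; exact: Oy.
- rewrite -subset0 => _ [[w [_ Ow] [k Kk <-]]] [v [nOv _] [h Kh vh]].
  apply: nOv; have := lowset_sub lO (Ow _ Kk) Kh.
  by rewrite -vh addrK.
Qed.

Lemma kprec_cut (O O' : set Y) : lowset O -> lowset O' -> O' !=set0 ->
  O `<=` O' -> kprec K (cut O) (cut O').
Proof.
move=> lO lO' O'0 OO' u [v| |] Ou.
- move=> [nO'v _] vu; apply: nO'v; apply: OO'; rewrite -(low_cut lO).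
  by exists u.
- by move=> _ [].
- by move=> /= O'e; have [z] := O'0; rewrite O'e.
Qed.

(** Let [z] be strictly below a point [u] of [M]. The partition places [z] below, on or above [U];
    in the last two cases some point of [U] would be strictly below [u]. *)
Lemma low_kprec (M U : set (\bar Y)) :
  Pp K U -> kprec K M U -> low M `<=` low U.
Proof.
move=> [V [VT _ _ _] <-] MU z [u Mu zu].
have : @setT Y z by [].
rewrite -VT => -[[[v Vv [k Kk vkz]]|Vz]|[v Vv [k Kk vkz]]].
- exists v%:E%E; first by exists v.
  by rewrite kltE -vkz subKr.
- by have [] := MU _ z%:E%E Mu; first by exists z.
- have [] := MU _ v%:E%E Mu; first by exists v.
  case: u Mu zu => [u| |] // _; rewrite !kltE => Kuz.
  rewrite -(subrK z u) -addrA; apply: cone_interior_add => //.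
  by rewrite -vkz addrAC subrr add0r; exact: interior_subset.
Qed.

(** * Intersections of lower sets as weak maxima *)

Section Intersection.
Context (O0 : set Y) (F : set (set Y)).
Context (lO0 : lowset O0) (O0n : O0 !=set0).
Context (lF : F `<=` lowset) (Fn : forall A, F A -> A !=set0).

Let D : set (\bar Y) := [set v | exists2 A, F A & eneg (cut A) v].

(** If [- w] is on the cut of [A], then [k = w - y] works; conversely [cut_below] supplies a cut
    point under [- y - k]. *)
Lemma low_eneg_cut y :
  low D y <-> exists2 A, F A & exists2 k, K^° k & ~ A (- y - k).
Proof.
split=> [[v [A FA]]|[A FA [k Kk nA]]].
  rewrite enegE; case: v => [w| |] //.
    move=> [nA _]; rewrite kltE => Kw; exists A => //; exists (w - y) => //.
    by rewrite opprB addKr.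
  by move=> /= Ae _; have [z] := Fn FA; rewrite Ae.
have [w Ow Kw] := cut_below (lF FA) nA (Fn FA).
exists (- w)%:E%E; first by exists A; rewrite // enegE /= opprK.
rewrite kltE; have := cone_interior_add Kcone Kk Kw.
by rewrite addrA [k + _]addrC subrK addrC.
Qed.

(** The hypothesis says that [O0] is the intersection of [F]. A point on the cut of [O0] is outside
    some [A], and it is on the cut of that [A] because [O0] is contained in [A]; so the maximum is
    attained. *)
Lemma wmax_of_intersection : F !=set0 ->
  (forall y, ~ O0 y <-> exists2 A, F A & ~ A y) -> eneg (cut O0) = wmax K D.
Proof.
move=> [A1 FA1] O0E.
have lowD y : low D y <-> exists2 k, K^° k & ~ O0 (- y - k).
  rewrite low_eneg_cut; split=> [[A FA [k Kk nA]]|[k Kk /O0E[A FA nA]]].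
    by exists k => //; apply/O0E; exists A.
  by exists A => //; exists k.
have subA A : F A -> O0 `<=` A.
  move=> FA y O0y; apply: contrapT => nOy.
  by have /(_ O0y) : ~ O0 y by apply/O0E; exists A.
apply/seteqP; rewrite /wmax wsupE; split=> v; rewrite enegE.
  case: v => [v| |].
  - move=> [nO0 O0k]; split.
      have /O0E[A FA nA] := nO0; exists A => //; rewrite enegE.
      by split=> // k Kk; exact/(subA _ FA)/O0k.
    split=> [/lowD[k Kk]|k Kk]; first by apply; exact: O0k.
    by apply/lowD; exists k => //; rewrite opprB addrAC subrr add0r.
  - by move=> /= O0e; have [z] := O0n; rewrite O0e.
  (* Every member of [F] is now the whole space, and [A1] puts -oo into [D]. *)
  - move=> /= O0T; split.
      exists A1 => //; rewrite enegE /= -subTset -O0T; exact: subA.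
    rewrite /= -subset0 => y /lowD[k _]; apply.
    by rewrite O0T.
case: v => [v| |] [[A FA]]; rewrite enegE.
- move=> [nA _] [nD _]; split.
    by move=> /(subA _ FA).
  move=> k Kk; apply: contrapT => nO0; apply: nD; apply/lowD.
  by exists k.
- by move=> /= Ae; have [z] := Fn FA; rewrite Ae.
- move=> _ /= D0; rewrite -subTset => y _; apply: contrapT => nO0.
  have [k Kk] := Kint; have : low D (- y - k).
    by apply/lowD; exists k => //; rewrite opprB opprK addrAC subrr add0r.
  by rewrite D0.
Qed.

(** Attainment gives one direction: a point outside [O0] dominates a cut point, which lies on the
    cut of some [A]. The other is weak duality: a point of [O0] outside some [A] would put a value
    of [wsup K D] into [low D]. *)
Lemma intersection_of_wmax : eneg (cut O0) = wmax K D ->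
  forall y, ~ O0 y <-> exists2 A, F A & ~ A y.
Proof.
move=> O0D y; split=> [nO0|[A FA nA] O0y].
  have [w Ow Kw] := cut_below lO0 nO0 O0n.
  have : eneg (cut O0) (- w)%:E%E by rewrite enegE /= opprK.
  rewrite O0D => -[[A FA]]; rewrite enegE /= opprK => -[nA _] _.
  by exists A => // Ay; apply: nA; exact: lowset_le (lF FA) Ay Kw.
have [topO0|OT] := pselect (O0 = setT).
  have : eneg (cut O0) -oo%E by rewrite enegE topO0.
  rewrite O0D /wmax wsupE => -[_ /= D0]; have [k Kk] := Kint.
  have : low D (- y - k); last by rewrite D0.
  apply/low_eneg_cut; exists A => //; exists k => //.
  by rewrite opprB opprK addrAC subrr add0r.
have [w Ow Kw] := cut_above lO0 O0y OT.
have : eneg (cut O0) (- w)%:E%E by rewrite enegE /= opprK.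
rewrite O0D /wmax wsupE => -[_ [nD _]]; apply: nD.
apply/low_eneg_cut; exists A => //; exists (w - y) => //.
by rewrite opprK subKr.
Qed.

End Intersection.

(** * Conjugates and epigraphs *)

Section Conjugates.
Context {X : tvsType R}.
Implicit Types (E : X -> \bar Y) (L : clin X Y).

Definition lowc E L : set Y := low (conjug K E L).

Lemma lowset_lowc E L : lowset (lowc E L).
Proof. exact: lowset_low. Qed.

Lemma conjugE E L : conjug K E L = cut (lowc E L).
Proof. by rewrite /lowc low_wsup /conjug wsupE. Qed.

Lemma lowc_n0 E L : eproper E -> lowc E L !=set0.
Proof.
move=> [En [x Ex]]; have [k Kk] := Kint; rewrite /lowc low_wsup.
move: (En x) Ex; rewrite /edom /=; case Exe: (E x) => [e| |] // _ _.
exists (L x - e - k), ((L x)%:E - E x)%E; first by exists x.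
by rewrite Exe -[((L x)%:E - _)%E]/((L x - e)%:E%E) kltE subKr.
Qed.

Lemma dom_conjE E L : dom_conj K E L <-> lowc E L <> setT.
Proof.
rewrite /dom_conj /= conjugE -cutT; split=> + h; apply; first by rewrite h.
rewrite -(low_cut (lowset_lowc E L)) h -subTset => y _.
by exists +oo%E; rewrite ?cutT.
Qed.

(** Properness makes [lowc E L] nonempty, so that [cut_below] finds a value of the conjugate under
    [y]. *)
Lemma epi_conjE E L y : eproper E -> epi_conj K E (L, y) <-> ~ lowc E L y.
Proof.
move=> pE; rewrite /epi_conj /= conjugE; split=> [[u Eu [k Kk]]|nEy].
  case: u Eu => // u [nEu _] [<-] Euk; apply: nEu.
  by apply: (lowset_le (lowset_lowc E L) Euk); rewrite addrAC subrr add0r.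
have [w Ew Kw] := cut_below (lowset_lowc E L) nEy (lowc_n0 L pE).
exists w%:E%E => //; exists (y - w) => //.
by rewrite -[LHS]/((w + (y - w))%:E%E) addrC subrK.
Qed.

Lemma Epi_conj_low E L U : Epi_conj K E (L, U) -> lowc E L `<=` low U.
Proof. by move=> [PU _ EU]; exact: low_kprec. Qed.

Lemma Epi_conj_cut E L (O : set Y) : lowset O -> O !=set0 -> O <> setT ->
  lowc E L `<=` O -> Epi_conj K E (L, cut O).
Proof.
move=> lO O0 OT EO; split=> /=; first exact: Pp_cut.
  by apply/dom_conjE => ET; apply: OT; rewrite -subTset -ET.
by rewrite conjugE; apply: kprec_cut => //; exact: lowset_lowc.
Qed.

End Conjugates.

(** * Extended epigraph sums through lower sets *)

Lemma lowset_shift (O : set Y) (c : Y) :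
  lowset O -> lowset [set x | O (x - c)].
Proof.
move=> lO y; split=> /= [/lO[k Kk Ok]|[k Kk Ok]].
  by exists k; rewrite //= addrAC.
by apply/lO; exists k; rewrite // addrAC.
Qed.

(** Members of an extended epigraph have larger lower sets than the conjugate, so a point on the cut
    of their sum is outside the sum for the conjugates. Conversely, enlarging one summand moves the
    cut up to any given outside point. *)
Lemma Psi_boxplus {X : tvsType R} (E1 E2 E3 : X -> \bar Y) (M : set (\bar Y))
    (L : clin X Y) (y : Y) :
  eproper E1 -> eproper E2 -> eproper E3 -> low M !=set0 ->
  Psi (boxplus K (boxplus K (boxplus K (Epi_conj K E1) (Epi_conj K E2))
    (Epi_conj K E3)) [set (0, M)]) (L, y) <->
  exists L' L'', ~ sumset (sumset (sumset (lowc E1 L')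
    (lowc E2 (L - L' - L''))) (lowc E3 L'')) (low M) y.
Proof.
move=> pE1 pE2 pE3 M0; split.
  move=> [_ [_ [_ [[L1 U1] /Epi_conj_low E1U [[L2 U2] /Epi_conj_low E2U <-]]
    [[L3 U3] /Epi_conj_low E3U <-]] [_ -> [<- <-]]]].
  rewrite uplusE !low_uplus => -[nUy _]; exists L1, L3 => Ey; apply: nUy.
  apply: sumsetS Ey => //; apply: sumsetS => //; apply: sumsetS => //.
  by rewrite (_ : _ - _ - _ = L2)// addr0 addrAC addrK [_ + L2]addrC addrK.
move=> [L' [L'' nA]].
have E1c := Epi_conj_cut (E := E1) (L := L').
have E2c := Epi_conj_cut (E := E2) (L := L - L' - L'').
have E3c := Epi_conj_cut (E := E3) (L := L'').
have l1 := lowset_lowc E1 L'; have l2 := lowset_lowc E2 (L - L' - L'').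
have l3 := lowset_lowc E3 L''; have lM := lowset_low M.
have n1 := lowc_n0 L' pE1; have n2 := lowc_n0 (L - L' - L'') pE2.
have n3 := lowc_n0 L'' pE3.
set A := sumset _ (low M) in nA.
set A1 := lowc E1 L' in A nA E1c l1 n1; set A2 := lowc E2 _ in A nA E2c l2 n2.
set A3 := lowc E3 _ in A nA E3c l3 n3.
have n12 := sumset_n0 n1 n2; have n123 := sumset_n0 n12 n3.
have lA : lowset A by rewrite /A; do 3 apply: lowset_sum => //.
have AT : A <> setT by move=> AT; apply: nA; rewrite AT.
(* As the total sum misses [y], no summand is the whole space, as membership in [Epi_conj]
   requires. *)
have [A123T _] := sumset_neqT n123 M0 AT.
have [A12T n3T] := sumset_neqT n12 n3 A123T.
have [n1T n2T] := sumset_neqT n1 n2 A12T.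
have [w Aw Kw] := cut_below lA nA (sumset_n0 n123 M0).
(* [y] lies only above the cut of [A]; shifting the first summand by [c] puts
   it on the cut. *)
pose c := y - w; pose B1 := [set x | A1 (x - c)].
have lB1 : lowset B1 by exact: lowset_shift.
exists (uplus K (uplus K (uplus K (cut B1) (cut A2)) (cut A3)) M); last first.
  rewrite uplusE !low_uplus !low_cut// !sumset_shift /= subKr.
  by move: Aw => [nw wk]; split=> // k Kk; rewrite addrAC subKr; exact: wk.
exists (L' + (L - L' - L'') + L'',
  uplus K (uplus K (cut B1) (cut A2)) (cut A3)).
  exists (L' + (L - L' - L''), uplus K (cut B1) (cut A2)).
    exists (L', cut B1).
      apply: E1c => //.
      - by move: n1 => [a Aa]; exists (a + c); rewrite /B1 /= addrK.
      - move=> BT; apply: n1T; rewrite -subTset => x _.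
        have : B1 (x + c) by rewrite BT.
        by rewrite /B1 /= addrK.
      - by move=> x A1x; apply: (lowset_le l1 A1x); rewrite subKr.
    by exists (L - L' - L'', cut A2) => //; exact: E2c.
  by exists (L'', cut A3) => //; exact: E3c.
exists (0, M) => //=; congr pair.
by rewrite addr0 -addrA subrK addrC subrK.
Qed.

Lemma eproper_indf {T : Type} (D : set T) :
  D !=set0 -> eproper (indf D : T -> \bar Y).
Proof.
move=> [x Dx]; split=> [z|]; first by rewrite /indf; case: ifP.
by exists x; rewrite /edom /indf /= mem_set.
Qed.

Lemma ecomp_nNy {T V : Type} (f : V -> \bar Y) (h : T -> \bar V) x :
  (forall v, f v <> -oo%E) -> ecomp f h x <> -oo%E.
Proof. by rewrite /ecomp; case: (h x). Qed.

Lemma adde_nNy (u v : \bar Y) : u <> -oo%E -> v <> -oo%E -> (u + v)%E <> -oo%E.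
Proof. by case: u v => [u| |] [v| |]. Qed.

(** * The composite problem *)

Section Composite.
Context {X Z W : tvsType R} (S : set Z) (C : set X).
Context (F : X -> \bar Y) (kappa : W -> \bar Y).
Context (H : X -> \bar W) (G : X -> \bar Z).
Context (Fproper : eproper F) (kproper : eproper kappa).
Context (feas : feasible S C G `&` edom F `&` H @^-1` (EFin @` edom kappa)
                  !=set0).

Lemma eproper_lagr (T1 : clin W Y) (T2 : clin Z Y) : eproper (lagr H G T1 T2).
Proof.
split=> [x|]; first by apply: adde_nNy; exact: ecomp_nNy.
have [x [[[_ [z _ Gz]] _] [w _ Hw]]] := feas; exists x.
by rewrite /edom /= /lagr /lcomp /ecomp -Gz -Hw.
Qed.

Lemma objective_nNy x : (F x + ecomp kappa H x)%E <> -oo%E.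
Proof.
by apply: adde_nNy; [exact: Fproper.1|apply: ecomp_nNy; exact: kproper.1].
Qed.

Lemma eproper_objective : eproper (objective S C F kappa H G).
Proof.
split=> [x|].
  by apply: adde_nNy; [exact: objective_nNy|rewrite /indf; case: ifP].
have [x [[Ax Fx] [w kw Hw]]] := feas; exists x.
move: Fx kw; rewrite /edom /= /objective /ecomp -Hw /indf mem_set//.
by case: (F x) => [f| |]; case: (kappa w).
Qed.

Lemma primalE (L : clin X Y) : primal K S C F kappa H G L =
  eneg (cut (lowc (objective S C F kappa H G) L)).
Proof.
have oppB (v : \bar Y) (a : Y) :
    v <> -oo%E -> (- (v - a%:E))%E = (a%:E - v)%E.
  by case: v => [v| |] // _; rewrite -[LHS]/((- (v - a))%:E%E) opprB.
have add0 (v : \bar Y) : (v + 0%:E)%E = v.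
  by case: v => [v| |] //; rewrite -[LHS]/((v + 0)%:E%E) addr0.
rewrite /primal /winf wsupE /lowc low_wsup; congr (eneg (cut _)).
apply/seteqP; split=> y [v].
  move=> [_ [x Ax <-] <-]; rewrite oppB; last exact: objective_nNy.
  exists ((L x)%:E - objective S C F kappa H G x)%E; first by exists x.
  by rewrite /objective /indf mem_set// add0.
move=> [x _ <-]; rewrite /objective /indf; case: ifPn => [/set_mem Ax|_].
  rewrite add0 -oppB; last exact: objective_nNy.
  move=> yv; exists (- (F x + ecomp kappa H x - (L x)%:E))%E => //.
  by exists (F x + ecomp kappa H x - (L x)%:E)%E => //; exists x.
(* An infeasible point contributes -oo to the conjugate, and nothing is strictly below -oo. *)
by move: (@objective_nNy x); case: (F x + _)%E.
Qed.

Context (adm : set (clin W Y * clin Z Y)) (C0 : C !=set0).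
Context (N : clin W Y * clin Z Y -> set (\bar Y)).
Context (N0 : forall T, low (N T) !=set0).

Definition dual_low (L L' L'' : clin X Y) T : set Y :=
  sumset (sumset (sumset (lowc F L') (lowc (lagr H G T.1 T.2) (L - L' - L'')))
    (lowc (indf C) L'')) (low (N T)).

Definition dual_lows (L : clin X Y) : set (set Y) :=
  [set A | exists L' L'' T, adm T /\ A = dual_low L L' L'' T].

(** Abstracting the admissible pairs as [adm] and the term depending on multipliers alone as [N]
    covers both equivalences at once. For each [L], both sides amount to [lowc f L] being the
    intersection of [dual_lows L]. *)
Lemma stable_strong_duality_iff (M : set (clin X Y * Y))
    (D : clin X Y -> set (\bar Y)) :
  (forall p, M p <-> exists2 T, adm T &
    Psi (boxplus K (boxplus K (boxplus K (Epi_conj K F)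
      (Epi_conj K (lagr H G T.1 T.2))) (Epi_conj K (indf C)))
      [set (0, N T)]) p) ->
  (forall L v, D L v <-> exists2 A, dual_lows L A & eneg (cut A) v) ->
  adm !=set0 \/ dom_conj K (objective S C F kappa H G) !=set0 ->
  epi_conj K (objective S C F kappa H G) = M <->
  stable_strong_duality K S C F kappa H G D.
Proof.
move=> ME DE adm0; set f := objective S C F kappa H G.
have MD L y : M (L, y) <-> exists2 A, dual_lows L A & ~ A y.
  rewrite ME; split=> [[T admT]|[_ [L' [L'' [T [admT ->]]]] nA]].
    have pC := eproper_indf C0.
    move/(Psi_boxplus _ _ Fproper (eproper_lagr T.1 T.2) pC (N0 T)).
    move=> [L' [L'' nA]]; exists (dual_low L L' L'' T) => //.
    by exists L', L'', T.
  exists T => //.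
  apply/(Psi_boxplus _ _ Fproper (eproper_lagr T.1 T.2) _ (N0 T)).
    exact: eproper_indf.
  by exists L', L''.
have {}DE L : D L = [set v | exists2 A, dual_lows L A & eneg (cut A) v].
  by apply/seteqP; split=> v /DE.
have lA L : dual_lows L `<=` lowset.
  move=> _ [L' [L'' [T [_ ->]]]].
  by rewrite /dual_low; do ?apply: lowset_sum; exact: lowset_low.
have An L A : dual_lows L A -> A !=set0.
  move=> [L' [L'' [T [_ ->]]]]; rewrite /dual_low; do ?apply: sumset_n0 => //.
  - exact: lowc_n0.
  - exact/lowc_n0/eproper_lagr.
  - exact/lowc_n0/eproper_indf.
have lf L := lowset_lowc f L.
have fn L : lowc f L !=set0 by exact/lowc_n0/eproper_objective.
split=> [fM L|ssd].
  (* If the conjugate of the objective has a point in its domain, its epigraph has a point, and the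
     assumed identity extracts an admissible pair from it. *)
  have admn : adm !=set0.
    case: adm0 => // -[L1 /dom_conjE /eqP/setTPn[y nfy]].
    have : M (L1, y) by rewrite -fM; apply/epi_conjE/nfy/eproper_objective.
    by move/ME => [T admT _]; exists T.
  rewrite primalE DE; apply: wmax_of_intersection => //; first exact: An.
    by have [T admT] := admn; exists (dual_low L 0 0 T), 0, 0, T.
  move=> y; rewrite -MD -fM; apply: iff_sym; apply: epi_conjE.
  exact: eproper_objective.
apply/seteqP; split=> -[L y].
  move/(epi_conjE _ _ eproper_objective) => nfy; apply/MD.
  apply/(intersection_of_wmax (lf L) (fn L) (lA L) (@An L)) => //.
  by rewrite -primalE ssd DE.
move/MD => h; apply/(epi_conjE _ _ eproper_objective).
apply/(intersection_of_wmax (lf L) (fn L) (lA L) (@An L)) => //.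
by rewrite -primalE ssd DE.
Qed.

End Composite.

End WeakSuprema.

(* If no T1 is admissible, the dual set is empty, so its WMax is empty, while
   the primal WInf never is. If moreover the conjugate of the objective is
   identically +oo, then both sides of the epigraph equality are empty, and the
   equivalence fails. The premise on each equivalence excludes exactly this. *)
Theorem corollary5p7 (R : realType) (X Y Z W : tvsType R)
    (hX : hausdorff_space X) (hY : hausdorff_space Y)
    (hZ : hausdorff_space Z) (hW : hausdorff_space W)
    (K : set Y) (Kcone : convex_cone K) (Kclosed : closed K)
    (Kproper : K <> setT) (Kint : interior K !=set0)
    (P : set W) (Pcone : convex_cone P) (P0 : P !=set0)
    (S : set Z) (Scone : convex_cone S) (S0 : S !=set0)
    (F : X -> \bar Y) (kappa : W -> \bar Y)
    (H : X -> \bar W) (G : X -> \bar Z)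
    (Fproper : eproper F) (kproper : eproper kappa)
    (Hproper : eproper H) (Gproper : eproper G)
    (C : set X) (C0 : C !=set0)
    (feas : feasible S C G `&` edom F `&` H @^-1` (EFin @` edom kappa)
              !=set0) :
  (dom_conj K kappa !=set0 \/
     dom_conj K (objective S C F kappa H G) !=set0 ->
   (epi_conj K (objective S C F kappa H G) = M3 K S C F kappa H G <->
    stable_strong_duality K S C F kappa H G (dual3 K S C F kappa H G))) /\
  (dom_conj K kappa `&` Lplus P K !=set0 \/
     dom_conj K (objective S C F kappa H G) !=set0 ->
   (epi_conj K (objective S C F kappa H G) = M3_plus K P S C F kappa H G <->
    stable_strong_duality K S C F kappa H G
      (dual3_plus K P S C F kappa H G))).

Proof.
have low0 (V : tvsType R) (E : V -> \bar Y) (L : clin V Y) :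
  eproper E -> low K (conjug K E L) !=set0 by exact: lowc_n0.
have pI : eproper (I_negS S : Z -> \bar Y).
  by apply: eproper_indf; have [s Ss] := S0; exists (- s), s.
split=> adm0.
  pose adm := [set T : clin W Y * clin Z Y |
    dom_conj K kappa T.1 /\ Lplusw S K T.2].
  pose N (T : clin W Y * clin Z Y) :=
    uplus K (conjug K kappa T.1) (conjug K (I_negS S) T.2).
  have N0 T : low K (N T) !=set0.
    by rewrite low_uplus//; apply: sumset_n0; exact: low0.
  apply: (stable_strong_duality_iff Kcone Kclosed Kint Fproper kproper feas
    (adm := adm) C0 (N := N) N0) => //.
  - move=> p; split=> [[T1 [T2 [kT1 ST2 h]]]|[[T1 T2] [kT1 ST2] h]].
      by exists (T1, T2).
    by exists T1, T2.
  - move=> L v; split.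
      move=> [L' [L'' [T1 [T2 [kT1 ST2 h]]]]].
      exists (dual_low K C F H G N L L' L'' (T1, T2)).
        by exists L', L'', (T1, T2).
      (* [dual3] adds the last two conjugates one after the other, [N] groups them; associativity of
         Minkowski sums reconciles both. *)
      by move: h; rewrite uplusE// !low_uplus// /dual_low low_uplus// sumsetA.
    move=> [_ [L' [L'' [[T1 T2] [[kT1 ST2] ->]]]] h].
    exists L', L'', T1, T2; split=> //.
    by move: h; rewrite uplusE// !low_uplus// /dual_low low_uplus// sumsetA.
  case: adm0 => [[T1 kT1]|]; [left|by right].
  (* The zero map is admissible because 0 is not interior to [K]. *)
  exists (T1, 0); split=> //; rewrite /Lplusw /= -subset0.
  move=> _ [[s _ <-] [k Kk]] /eqP; rewrite oppr_eq0 => /eqP k0.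
  by apply: (cone_interior_n0 Kcone Kproper); rewrite -k0.
pose adm := [set T : clin W Y * clin Z Y |
  (dom_conj K kappa `&` Lplus P K) T.1 /\ Lplus S K T.2].
pose N (T : clin W Y * clin Z Y) := conjug K kappa T.1.
have N0 T : low K (N T) !=set0 by exact: low0.
apply: (stable_strong_duality_iff Kcone Kclosed Kint Fproper kproper feas
  (adm := adm) C0 (N := N) N0) => //.
- move=> p; split=> [[T1 [T2 [kT1 ST2 h]]]|[[T1 T2] [kT1 ST2] h]].
    by exists (T1, T2).
  by exists T1, T2.
- move=> L v; split.
    move=> [L' [L'' [T1 [T2 [kT1 ST2 h]]]]].
    exists (dual_low K C F H G N L L' L'' (T1, T2)).
      by exists L', L'', (T1, T2).
    by move: h; rewrite uplusE// !low_uplus.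
  move=> [_ [L' [L'' [[T1 T2] [[kT1 ST2] ->]]]] h].
  exists L', L'', T1, T2; split=> //.
  by move: h; rewrite uplusE// !low_uplus.
case: adm0 => [[T1 kT1]|]; [left|by right].
(* Here the zero map is admissible because [K] contains 0. *)
by exists (T1, 0); split=> // _ [s _ <-]; exact: (cone0 Kcone Kclosed Kint).
Qed.
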